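(* Let $k\ge 2$ be an integer, $S>0$ and $h\ne 0$ real. Suppose real numbers $a,b,c,d\ge 0$ satisfy $a^k+b^k=c^k+d^k$, $a+b=S$, $c+d=S+h$. If $h>0$, then with $\delta=|a-b|/2$, \[ \delta^2\ \ge\ \frac{Sh}{2(k-1)}. \] Symmetrically, if $h<0$, then with $\delta'=|c-d|/2$, one has $\delta'^2\ge \dfrac{(S+h)|h|}{2(k-1)}$. *)

(* Defs.v *)
From mathcomp Require Export all_boot all_order all_algebra.
From mathcomp Require Export reals.
Set Implicit Arguments.
Unset Strict Implicit.
Unset Printing Implicit Defensive.

(* Main.v *)
(** Write [a = m (1 + t)], [b = m (1 - t)] with [m = S / 2].  The power mean
    inequality bounds [c ^+ k + d ^+ k] below by [2 ((S + h) / 2) ^+ k], so it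
    suffices that the even part [((1 + t) ^+ k + (1 - t) ^+ k) / 2] is at most
    [(1 + (k - 1) t ^+ 2 / 2) ^+ k].  The even parts [A_k] satisfy
    [A_k = 1 + t ^+ 2 * \sum_(j < k) \sum_(i < j) A_i], so by strong induction
    [A_i <= u ^+ i] with [u = 1 + (k - 1) t ^+ 2 / 2], and the resulting double
    geometric sum is controlled by a Chebyshev-type inequality, [u >= 1].  The
    case [h < 0] is the same inequality with the two pairs exchanged. *)
Require Import Defs.
From mathcomp Require Import all_boot all_order all_algebra.
From mathcomp Require Import reals.
From mathcomp Require Import ring lra.
Import Order.TTheory GRing.Theory Num.Theory.
Local Open Scope ring_scope.

Section EvenPart.
Set Implicit Arguments. Unset Strict Implicit.
Variable R : realFieldType.
Implicit Types (a b c d m t u x : R) (k n i j : nat).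

Definition even_part m x k : R := ((m + x) ^+ k + (m - x) ^+ k) / 2.
Definition odd_part m x k : R := ((m + x) ^+ k - (m - x) ^+ k) / 2.

Lemma even_part0 m x : even_part m x 0 = 1.
Proof. by rewrite /even_part !expr0; field. Qed.

Lemma odd_part0 m x : odd_part m x 0 = 0.
Proof. by rewrite /odd_part !expr0 subrr mul0r. Qed.

Lemma even_partS m x k :
  even_part m x k.+1 = m * even_part m x k + x * odd_part m x k.
Proof. by rewrite /even_part /odd_part !exprS; field. Qed.

Lemma odd_partS m x k :
  odd_part m x k.+1 = m * odd_part m x k + x * even_part m x k.
Proof. by rewrite /even_part /odd_part !exprS; field. Qed.

(** Two-point power mean inequality. The odd part has the sign of [x], so the induction also carries
    [0 <= x * odd_part m x k]. *)
Lemma even_part_ge m x k : 0 <= m -> m ^+ k <= even_part m x k.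
Proof.
move=> m0; suff [] : m ^+ k <= even_part m x k /\ 0 <= x * odd_part m x k by [].
elim: k => [|k [IHe IHo]]; first by rewrite even_part0 odd_part0 mulr0.
have e0 : 0 <= even_part m x k by apply: le_trans IHe; apply: exprn_ge0.
rewrite even_partS odd_partS exprS; split.
  by rewrite -[leLHS]addr0 lerD // ler_wpM2l.
rewrite mulrDr mulrCA [x * (x * _)]mulrA -expr2.
by apply: addr_ge0; apply: mulr_ge0 => //; apply: sqr_ge0.
Qed.

Lemma odd_part_sum t k :
  odd_part 1 t k = t * \sum_(i < k) even_part 1 t i.
Proof.
elim: k => [|k IHk]; first by rewrite odd_part0 big_ord0 mulr0.
by rewrite odd_partS big_ord_recr /= mulrDr -IHk mul1r.
Qed.

(** At [m = 1] each part grows per step by [t] times the other, so summing twice yields the factor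
    [t ^+ 2]. *)
Lemma even_part_sum t k :
  even_part 1 t k = 1 + t ^+ 2 * \sum_(j < k) \sum_(i < j) even_part 1 t i.
Proof.
elim: k => [|k IHk]; first by rewrite even_part0 big_ord0 mulr0 addr0.
by rewrite even_partS big_ord_recr /= odd_part_sum mul1r IHk; ring.
Qed.

(** On the left [u ^+ i] is counted [n - i] times: weights that decrease, with average [n / 2],
    against terms that do not. *)
Lemma double_geometric_sum_le u n : 1 <= u ->
  2 * \sum_(j < n.+1) \sum_(i < j) u ^+ i <= n%:R * \sum_(i < n.+1) u ^+ i.
Proof.
move=> u1; elim: n => [|n IHn].
  by rewrite big_ord1 big_ord0 mulr0 mul0r.
have sum_le : \sum_(i < n.+1) u ^+ i <= n.+1%:R * u ^+ n.+1.
  have -> : n.+1%:R * u ^+ n.+1 = \sum_(i < n.+1) u ^+ n.+1.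
    by rewrite sumr_const card_ord mulr_natl.
  by apply: ler_sum => i _; apply: ler_weXn2l => //; apply: ltnW.
rewrite big_ord_recr /= [in leRHS]big_ord_recr /=.
move: IHn sum_le; rewrite -[n.+1%:R]natr1.
set D := \sum_(j < _) _; set E := \sum_(i < _) _; set U := u ^+ _.
by move: D E U => D E U; lra.
Qed.

Lemma even_part_le t k :
  even_part 1 t k.+1 <= (1 + k%:R * t ^+ 2 / 2) ^+ k.+1.
Proof.
elim/ltn_ind: k => k IHk; set u := 1 + _.
have t2 := sqr_ge0 t.
have u1 : 1 <= u by rewrite lerDl divr_ge0 // mulr_ge0.
(* For exponent [i.+1] the induction hypothesis has base [1 + i%:R * t ^+ 2 / 2], at most [u]. *)
have le_u i : (i <= k)%N -> even_part 1 t i <= u ^+ i.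
  case: i => [|i] ik; first by rewrite even_part0 expr0.
  apply: le_trans (IHk i ik) _; apply: lerXn2r.
  - by rewrite nnegrE addr_ge0 // divr_ge0 // mulr_ge0.
  - by rewrite nnegrE; apply: le_trans u1.
  by rewrite lerD2l ler_pM2r ?invr_gt0 // ler_wpM2r // ler_nat ltnW.
have le_sum : \sum_(j < k.+1) \sum_(i < j) even_part 1 t i
           <= \sum_(j < k.+1) \sum_(i < j) u ^+ i.
  apply: ler_sum => j _; apply: ler_sum => i _; apply: le_u.
  by apply: ltnW; apply: leq_trans (ltn_ord i) _; rewrite -ltnS.
(* Factoring [u ^+ k.+1 - 1] as [u - 1] times a geometric sum lets [t ^+ 2] cancel on both sides. *)
rewrite even_part_sum -[leRHS](subrK 1) subrX1 [leRHS]addrC lerD2l.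
have -> : u - 1 = t ^+ 2 * (k%:R / 2) by rewrite /u; field.
rewrite -[leRHS]mulrA ler_wpM2l //; apply: le_trans le_sum _.
have := double_geometric_sum_le k u1; lra.
Qed.

Lemma sqr_half_diff_ge k a b c d : (2 <= k)%N ->
  0 <= a -> 0 <= b -> 0 <= c -> 0 <= d -> a ^+ k + b ^+ k = c ^+ k + d ^+ k ->
  (a + b) * (c + d - (a + b)) / (2 * (k%:R - 1)) <= ((a - b) / 2) ^+ 2.
Proof.
case: k => // n n1 a0 b0 c0 d0 eq_pow.
have n0 : (0 : R) < n%:R by rewrite ltr0n.
have [ab0|ab_neq0] := eqVneq (a + b) 0.
  by rewrite ab0 !mul0r sqr_ge0.
have ab_gt0 : 0 < a + b by rewrite lt_def ab_neq0 addr_ge0.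
rewrite -[n.+1%:R]natr1 addrK ler_pdivrMr ?mulr_gt0 // leNgt; apply/negP => lt_h.
pose m := (a + b) / 2; pose t := (a - b) / (a + b).
have m0 : 0 < m by rewrite divr_gt0.
have aE : a = m * (1 + t) by rewrite /m /t; field.
have bE : b = m * (1 - t) by rewrite /m /t; field.
pose u := 1 + n%:R * t ^+ 2 / 2.
have u0 : 0 <= m * u.
  by rewrite mulr_ge0 ?(ltW m0) // addr_ge0 // divr_ge0 // mulr_ge0 // sqr_ge0.
(* Up to a positive factor this is the negated bound [lt_h]. *)
have lt_mean : m * u < (c + d) / 2.
  rewrite -subr_gt0 -(pmulr_rgt0 _ ab_gt0).
  have -> : (a + b) * ((c + d) / 2 - m * u) =
    ((a + b) * (c + d - (a + b)) - ((a - b) / 2) ^+ 2 * (2 * n%:R)) / 2.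
    by rewrite /m /u /t; field.
  by rewrite divr_gt0 // subr_gt0.
have lt_pow : (m * u) ^+ n.+1 < ((c + d) / 2) ^+ n.+1.
  by rewrite ltrXn2r // nnegrE divr_ge0 // addr_ge0.
have cd_mean : ((c + d) / 2) ^+ n.+1 <= (c ^+ n.+1 + d ^+ n.+1) / 2.
  have -> : (c ^+ n.+1 + d ^+ n.+1) / 2
          = even_part ((c + d) / 2) ((c - d) / 2) n.+1.
    by rewrite /even_part; congr ((_ ^+ _ + _ ^+ _) / _); field.
  by rewrite even_part_ge // divr_ge0 // addr_ge0.
(* Cancelling [m ^+ n.+1] leaves [u ^+ n.+1 < even_part 1 t n.+1], against [even_part_le]. *)
move: (lt_le_trans lt_pow cd_mean); clearbody m.
rewrite -eq_pow {1}aE {1}bE !exprMn -mulrDr -[ltRHS]mulrA ltr_pM2l ?exprn_gt0 //.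
by rewrite ltNge even_part_le.
Qed.

End EvenPart.

Theorem theorem5p4 (R : realType) (k : nat) (S h a b c d : R)
  (hk : (2 <= k)%N) (hS : 0 < S) (hh : h != 0)
  (ha : 0 <= a) (hb : 0 <= b) (hc : 0 <= c) (hd : 0 <= d)
  (hpow : a ^+ k + b ^+ k = c ^+ k + d ^+ k)
  (hab : a + b = S) (hcd : c + d = S + h) :
  (0 < h ->
     let delta := `|a - b| / 2 in
     delta ^+ 2 >= S * h / (2 * (k%:R - 1))) /\
  (h < 0 ->
     let delta' := `|c - d| / 2 in
     delta' ^+ 2 >= (S + h) * `|h| / (2 * (k%:R - 1))).
Proof.
split=> h_sign /=; rewrite exprMn real_normK ?num_real // -exprMn.
  have := sqr_half_diff_ge hk ha hb hc hd hpow.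
  by rewrite hab hcd addrAC subrr add0r.
have := sqr_half_diff_ge hk hc hd ha hb (esym hpow).
by rewrite ltr0_norm // hab hcd opprD addrA subrr add0r.
Qed.
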